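(* Properties AMUC and AUC are equivalent up to renorming in the class of duals of separable Banach spaces with a weak$^*$ unconditional asymptotic structure; that is, if $X$ is a separable Banach space such that $X^*$ has a weak$^*$ unconditional asymptotic structure, then $X^*$ admits an equivalent AMUC norm if and only if $X^*$ admits an equivalent AUC norm.
   Context: $S_Y$ denotes the unit sphere of $Y$; $\inf\emptyset=+\infty$. A norm on a Banach space $Z$ is AUC if for all $t>0$, $\inf_{z\in S_Z}\sup_Y\inf_{y\in S_Y}(\|z+ty\|-1)>0$, and AMUC if for all $t>0$, $\inf_{z\in S_Z}\sup_Y\inf_{y\in S_Y}(\max\{\|z+ty\|,\|z-ty\|\}-1)>0$, the suprema being over all closed subspaces $Y$ of $Z$ of finite codimension. Let $\mathrm{cof}_{w^*}(X^* )$ be the set of weak$^*$-closed subspaces of $X^*$ of finite codimension. $X^*$ has a weak$^*$ unconditional asymptotic structure if there is $C\ge1$ such that for every $n\ge1$: $\exists X_1\in\mathrm{cof}_{w^*}(X^* )\ \forall x_1^*\in S_{X_1}\ \cdots\ \exists X_n\in\mathrm{cof}_{w^*}(X^* )\ \forall x_n^*\in S_{X_n}$: $(x_i^* )_{i=1}^n$ is $C$-unconditional, i.e. $\|\sum\epsilon_ia_ix_i^*\|\le C\|\sum a_ix_i^*\|$ for all scalars $a_i$ and signs $\epsilon_i$. *)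

(* Defs.v *)
From HB Require Import structures.
From mathcomp Require Import all_boot all_order all_algebra.
From mathcomp Require Import all_classical all_reals all_analysis.

Set Implicit Arguments.
Unset Strict Implicit.
Unset Printing Implicit Defensive.

Import Order.TTheory GRing.Theory Num.Theory.
Import numFieldNormedType.Exports.

Local Open Scope classical_set_scope.
Local Open Scope ring_scope.

Section Dual.
Context {R : realType} (X : normedModType R).

Definition is_functional : {pred X -> R^o} :=
  fun f => `[< linear f /\ continuous f >].

Record dual := Dual {
  dual_fun :> X -> R^o;
  dual_funP : dual_fun \in is_functional }.

HB.instance Definition _ := [isSub for dual_fun].
HB.instance Definition _ := [Choice of dual by <:].

Lemma is_functional_submod_closed : submod_closed is_functional.
Proof.
split.
  apply/asboolP; split; last by move=> x; exact: cvg_cst.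
  by move=> a x y /=; rewrite scaler0 addr0.
move=> a f g /asboolP[lf cf] /asboolP[lg cg]; apply/asboolP; split.
  move=> b x y; rewrite -[LHS]/(a *: f (b *: x + y) + g (b *: x + y)) lf lg.
  by rewrite scalerDr addrACA !scalerA [a * b]mulrC -scalerA -scalerDr.
by move=> x; apply: cvgD; [apply: cvgZl_tmp; exact: cf|exact: cg].
Qed.

HB.instance Definition _ :=
  GRing.isSubmodClosed.Build R (X -> R^o) is_functional
    is_functional_submod_closed.
HB.instance Definition _ := [SubChoice_isSubLmodule of dual by <:].

Lemma dual_linear (f : dual) : linear f.
Proof. by have /asboolP[] := dual_funP f. Qed.

HB.instance Definition _ (f : dual) :=
  GRing.isLinear.Build R X R^o *:%R f (dual_linear f).

Lemma dual_continuous (f : dual) : continuous f.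
Proof. by have /asboolP[] := dual_funP f. Qed.

Definition dual_norm (f : dual) : R :=
  sup [set `|f x| | x in [set x : X | `|x| <= 1]].

Lemma dual_has_sup (f : dual) :
  has_sup [set `|f x| | x in [set x : X | `|x| <= 1]].
Proof.
split; first by exists `|f 0|, 0 => //=; rewrite normr0.
have /bounded_funP /(_ 1)[M fM] :=
  (linear_bounded_continuous f).2 (@dual_continuous f).
by exists M => _ [x /= x1 <-]; exact: fM.
Qed.

Lemma dual_norm_ub (f : dual) x : `|x| <= 1 -> `|f x| <= dual_norm f.
Proof. by move=> x1; apply: (sup_upper_bound (dual_has_sup f)); exists x. Qed.

Lemma dual_norm_le (f : dual) M :
  (forall x, `|x| <= 1 -> `|f x| <= M) -> dual_norm f <= M.
Proof.
move=> fM; apply: ge_sup; first by case: (dual_has_sup f).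
by move=> _ [x x1 <-]; exact: fM.
Qed.

Lemma dual_norm_ge0 (f : dual) : 0 <= dual_norm f.
Proof. by apply: le_trans (dual_norm_ub f (x := 0) _); rewrite ?normr0. Qed.

Lemma ler_dual_normD (f g : dual) :
  dual_norm (f + g) <= dual_norm f + dual_norm g.
Proof.
apply: dual_norm_le => x x1; apply: le_trans (ler_normD _ _) _.
by apply: lerD; exact: dual_norm_ub.
Qed.

Lemma dual_normZ (a : R) (f : dual) : dual_norm (a *: f) = `|a| * dual_norm f.
Proof.
apply/eqP; rewrite eq_le; apply/andP; split.
  apply: dual_norm_le => x x1.
  by rewrite [X in X <= _](normrM a (f x)) ler_wpM2l// dual_norm_ub.
have [->|a0] := eqVneq a 0; first by rewrite normr0 mul0r dual_norm_ge0.
rewrite -ler_pdivlMl ?normr_gt0//; apply: dual_norm_le => x x1.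
rewrite ler_pdivlMl ?normr_gt0// -normrM.
exact: (@dual_norm_ub (a *: f) x x1).
Qed.

Lemma dual_norm_eq0 (f : dual) : dual_norm f = 0 -> f = 0.
Proof.
move=> f0; apply/val_inj/funext => x /=.
have [->|x0] := eqVneq x 0; first by rewrite linear0.
have xgt0 : 0 < `|x| by rewrite normr_gt0.
have : `|f (`|x|^-1 *: x)| <= 0.
  rewrite -f0; apply: dual_norm_ub.
  by rewrite normrZ ger0_norm ?invr_ge0// mulVf// gt_eqF.
rewrite normr_le0 linearZ/= => /eqP/(congr1 (fun z => `|x| * z)).
by rewrite mulr0 [X in _ * X]/(_ * _) mulrA mulfV ?gt_eqF// mul1r.
Qed.

HB.instance Definition _ :=
  Lmodule_isNormed.Build R dual ler_dual_normD dual_normZ dual_norm_eq0.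

(* The weak* topology on the dual is the topology of pointwise convergence. *)
Definition weak_star_closed (A : set dual) :=
  closed (A : set (initial_topology (dual_fun : dual -> {ptws X -> R^o}))).

End Dual.

Section Subspaces.
Context {R : realType} (Z : lmodType R).

(* Y is a linear subspace, and finitely many vectors span Z modulo Y. *)
Definition fin_codim_subspace (Y : set Z) :=
  [/\ Y 0, forall (a : R) u v, Y u -> Y v -> Y (a *: u + v) &
      exists n (e : 'I_n -> Z), forall z, exists a : 'I_n -> R,
        Y (z - \sum_(i < n) a i *: e i)].

End Subspaces.

Section Renormings.
Context {R : realType} (Z : normedModType R).

Record is_equivalent_norm (N : Z -> R) : Prop := {
  eqnorm_triangle : forall x y, N (x + y) <= N x + N y;
  eqnorm_homogeneous : forall a x, N (a *: x) = `|a| * N x;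
  eqnorm_definite : forall x, N x = 0 -> x = 0;
  eqnorm_bounds : exists c C : R,
    [/\ 0 < c, 0 < C & forall x, c * `|x| <= N x <= C * `|x|] }.

Definition unit_sphere (N : Z -> R) : set Z := [set z | N z = 1].

Definition cof : set (set Z) :=
  [set Y | fin_codim_subspace Y /\ closed Y].

Local Open Scope ereal_scope.

(* In both definitions N is meant to be an equivalent norm on Z, so that the
   topology of Z used in cof is the one induced by N. Infima are taken in the
   extended reals, where ereal_inf set0 = +oo. *)
Definition AUC (N : Z -> R) := forall t : R, (0 < t)%R ->
  0 < ereal_inf [set
        ereal_sup [set
          ereal_inf [set (N (z + t *: y) - 1)%:E | y in Y `&` unit_sphere N]
        | Y in cof]
      | z in unit_sphere N].

Definition AMUC (N : Z -> R) := forall t : R, (0 < t)%R ->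
  0 < ereal_inf [set
        ereal_sup [set
          ereal_inf [set (Num.max (N (z + t *: y)) (N (z - t *: y)) - 1)%:E
                    | y in Y `&` unit_sphere N]
        | Y in cof]
      | z in unit_sphere N].

End Renormings.

Section WeakStarUnconditional.
Context {R : realType} (X : normedModType R).

Definition cof_weak_star : set (set (dual X)) :=
  [set Y | fin_codim_subspace Y /\ weak_star_closed Y].

Definition unconditional (C : R) (s : seq (dual X)) :=
  forall (a : 'I_(size s) -> R) (eps : 'I_(size s) -> bool),
    `|\sum_(i < size s) ((-1) ^+ eps i * a i) *: s`_i|
    <= C * `|\sum_(i < size s) a i *: s`_i|.

(* asymptotic_unconditional C n s reads: there is X_1 such that for all x_1 in
   its sphere, ..., there is X_n such that for all x_n in its sphere, the
   family s ++ [:: x_1; ...; x_n] is C-unconditional. *)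
Fixpoint asymptotic_unconditional (C : R) (n : nat) (s : seq (dual X)) : Prop :=
  if n is m.+1 then
    exists2 Y, cof_weak_star Y &
      forall x, Y x -> `|x| = 1 -> asymptotic_unconditional C m (rcons s x)
  else unconditional C s.

Definition weak_star_unconditional_asymptotic_structure :=
  exists2 C : R, 1 <= C &
    forall n, (1 <= n)%N -> asymptotic_unconditional C n [::].

End WeakStarUnconditional.

Definition separable (T : topologicalType) :=
  exists2 D : set T, countable D & dense D.

(* Main.v *)
Require Import Defs.
From mathcomp Require Import all_boot all_order all_algebra.
From mathcomp Require Import all_classical all_reals all_analysis.
From mathcomp Require Import ring lra.

(** Only one implication has content, since [AUC] asks for more than [AMUC].

    Let [N] be an equivalent [AMUC] norm on the dual of [X].  Although the
    subspaces in its definition are only norm closed, they can be replaced by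
    annihilators of finite sets of vectors ([AMUC_growth]): a weak* small
    perturbation is not close to a given subspace of finite codimension, but
    half the difference of two of them is.  Hence, along a sequence of
    successively weak* small functionals bounded from below, signs can be
    chosen such that the norms of the signed partial sums keep growing.  When
    the sequence is picked within the weak* unconditional asymptotic structure,
    the sums without signs must grow as well.  This contradicts the existence
    of a point in a late Szlenk derivative of the unit ball, from which one
    descends to the ball by weak* small steps with bounded sums: for every
    [eps], some finite iterate of the [eps]-derivation of the ball is empty
    ([szlenk_empty]).

    It remains to renorm a dual with this property.  In the predual, one plays
    [n] times a small step [s *: y] with [y] weakly small in the unit ball.  By
    weak* compactness of the derivatives, each step increases a functional of
    the ball by at most about [s * eps], except for a number of large increases
    that is bounded independently of [n] ([game_upper]).  Averaging the values
    of the games of lengths [0] to [n - 1] yields a convex function that hardly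
    increases along weakly small steps, and a sublevel set [D] of it has the
    corresponding property ([flat_set]).  The norm on the dual given by the
    supremum over [D] then increases by a fixed amount along the directions of
    norm much larger than [eps] in a weak* closed subspace of finite
    codimension.  The supremum over combinations of sets [D], for a sequence of
    [eps] that tends to [0], is the equivalent [AUC] norm ([mix_norm_AUC]).  *)

Set Implicit Arguments.
Unset Strict Implicit.
Unset Printing Implicit Defensive.

Import Order.TTheory GRing.Theory Num.Theory.
Import numFieldNormedType.Exports.

Local Open Scope classical_set_scope.
Local Open Scope ring_scope.

(** * Functionals and annihilators *)

Section Annihilators.
Context {R : realType} {X : normedModType R}.
Implicit Types (f g : dual X) (x y : X) (H : seq X).

Lemma dual0E x : (0 : dual X) x = 0 :> R. Proof. by []. Qed.
Lemma dualDE f g x : (f + g) x = f x + g x :> R. Proof. by []. Qed.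
Lemma dualBE f g x : (f - g) x = f x - g x :> R. Proof. by []. Qed.
Lemma dualZE (a : R) f x : (a *: f) x = a * f x :> R. Proof. by []. Qed.

Lemma dual_addE f x y : f (x + y) = f x + f y :> R.
Proof. exact: linearD. Qed.

Lemma dual_subE f x y : f (x - y) = f x - f y :> R.
Proof. exact: linearB. Qed.

Lemma dual_scaleE f (a : R) x : f (a *: x) = a * f x :> R.
Proof. exact: linearZ. Qed.

Lemma dual_eval0 f : f 0 = 0 :> R.
Proof. exact: linear0. Qed.

Lemma dual_apply_le1 f x : `|x| <= 1 -> `|f x : R| <= `|f|.
Proof. exact: dual_norm_ub. Qed.

Lemma dual_apply_le f x : `|f x : R| <= `|f| * `|x|.
Proof.
have [->|x0] := eqVneq x 0; first by rewrite dual_eval0 !normr0 mulr0.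
have xgt0 : 0 < `|x| by rewrite normr_gt0.
have := @dual_apply_le1 f (`|x|^-1 *: x).
rewrite normrZ normfV normr_id mulVf ?gt_eqF// => /(_ (lexx _)).
by rewrite dual_scaleE normrM normfV normr_id mulrC ler_pdivrMr.
Qed.

Lemma dual_half_norming f : exists x, `|x| <= 1 /\ `|f| / 2 <= f x.
Proof.
apply: contrapT => /forallNP h.
have le_half : `|f| <= `|f| / 2.
  apply: dual_norm_le => x x1; rewrite leNgt; apply/negP => lt_x.
  have [fx0|fx0] := leP 0 (f x : R).
    by apply: (h x); split => //; rewrite ger0_norm// in lt_x; exact: ltW.
  apply: (h (- 1 *: x)); split; first by rewrite scaleN1r normrN.
  by rewrite dual_scaleE mulN1r; rewrite ltr0_norm// in lt_x; exact: ltW.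
apply: (h 0); rewrite normr0 dual_eval0; split => //.
by have := normr_ge0 f; lra.
Qed.

Definition ann H : set (dual X) := [set f | forall x, x \in H -> f x = 0].

Lemma ann_cons x H f : ann (x :: H) f <-> f x = 0 /\ ann H f.
Proof.
split=> [fH|[fx fH] y]; last by rewrite inE => /predU1P[->|/fH].
by split=> [|y yH]; apply: fH; rewrite inE ?eqxx ?yH ?orbT.
Qed.

Lemma ann_cat H H' f : ann (H ++ H') f <-> ann H f /\ ann H' f.
Proof.
split=> [fH|[fH fH'] y]; last by rewrite mem_cat => /orP[/fH|/fH'].
by split=> y yH; apply: fH; rewrite mem_cat yH ?orbT.
Qed.

Lemma ann0 H : ann H 0. Proof. by move=> x _. Qed.

Lemma annP H (a : R) f g : ann H f -> ann H g -> ann H (a *: f + g).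
Proof.
by move=> fH gH x xH; rewrite dualDE dualZE fH// gH// mulr0 addr0.
Qed.

Lemma annZ H (a : R) f : ann H f -> ann H (a *: f).
Proof. by move=> fH x xH; rewrite dualZE fH// mulr0. Qed.

Lemma annB H f g : ann H f -> ann H g -> ann H (f - g).
Proof. by move=> fH gH x xH; rewrite dualBE fH// gH// subr0. Qed.

(** By induction on [H]: a functional already moved into the annihilator of
    the tail is corrected along one functional of that annihilator that does
    not vanish at the head. *)
Lemma ann_near H : exists2 c : R, 0 < c & forall f (eta : R), 0 <= eta ->
  (forall x, x \in H -> `|f x : R| <= eta) ->
  exists2 g, ann H g & `|f - g| <= c * eta.
Proof.
elim: H => [|x H [c c0 IH]].
  exists 1 => // f eta eta0 _; exists f; first by move=> x; rewrite in_nil.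
  by rewrite subrr normr0 mul1r.
have [[e eH ex]|noe] := pselect (exists2 e : dual X, ann H e & e x != 0 :> R).
  pose k := `|e| / `|e x : R|; have k0 : 0 <= k by rewrite divr_ge0.
  exists (c + (1 + c * `|x|) * k).
    by rewrite ltr_pwDl// mulr_ge0// addr_ge0// mulr_ge0// ltW.
  move=> f eta eta0 feta.
  have [|g gH fg] := IH f eta eta0.
    by move=> y yH; apply: feta; rewrite inE yH orbT.
  exists (g - (g x / e x) *: e).
    apply/ann_cons; split; last by apply: annB => //; exact: annZ.
    by rewrite dualBE dualZE divfK// subrr.
  have -> : f - (g - (g x / e x) *: e) = (f - g) + (g x / e x) *: e.
    by rewrite opprB addrCA addrC.
  apply: le_trans (ler_normD _ _) _; rewrite mulrDl lerD// normrZ normrM normfV.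
  have -> : `|g x : R| / `|e x : R| * `|e| = `|g x : R| * k by rewrite /k mulrAC mulrA.
  rewrite [leRHS]mulrAC ler_wpM2r//.
  have -> : g x = f x - (f - g) x by rewrite dualBE opprB addrC subrK.
  apply: le_trans (ler_normB _ _) _; rewrite mulrDl mul1r lerD//.
    by apply: feta; rewrite inE eqxx.
  apply: le_trans (dual_apply_le _ _) _.
  by rewrite [leRHS]mulrAC ler_wpM2r.
exists c => // f eta eta0 feta.
have [|g gH fg] := IH f eta eta0.
  by move=> y yH; apply: feta; rewrite inE yH orbT.
exists g => //; apply/ann_cons; split=> //.
by apply/eqP/negP => /negP gx; apply: noe; exists g.
Qed.

Lemma ann_fin_codim H : fin_codim_subspace (ann H).
Proof.
split; [exact: ann0|by move=> a u v; exact: annP|].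
elim: H => [|x H [n [e eP]]].
  exists 0%N, (fun=> 0) => z; exists (fun=> 0) => x; by rewrite in_nil.
have [[d dH dx]|nod] := pselect (exists2 d : dual X, ann H d & d x != 0 :> R).
  exists n.+1, (fun i => if unlift ord0 i is Some j then e j else d) => z.
  have [a aP] := eP z.
  set y := z - _ in aP.
  exists (fun i => if unlift ord0 i is Some j then a j else y x / d x).
  rewrite big_ord_recl unlift_none.
  under eq_bigr do rewrite liftK.
  rewrite opprD addrCA addrC -/y; apply/ann_cons; split.
    by rewrite dualBE dualZE divfK// subrr.
  by apply: annB => //; exact: annZ.
exists n, e => z; have [a aP] := eP z; exists a; apply/ann_cons; split=> //.
apply/eqP/negP => /negP gx; apply: nod.
by exists (z - \sum_(i < n) a i *: e i).
Qed.

Lemma ann_closed H : closed (ann H : set (dual X)).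
Proof.
move=> f clf x xH; apply/eqP; rewrite -normr_le0 leNgt; apply/negP => fx0.
have x0 : 0 < 1 + `|x| by rewrite ltr_pwDl.
have : nbhs f (ball f (`|f x : R| / (1 + `|x|))).
  by apply: nbhsx_ballx; rewrite divr_gt0.
move=> /clf[g [gH]]; rewrite -ball_normE /= ltr_pdivlMr// => lt.
have := dual_apply_le (f - g) x; rewrite dualBE (gH x xH) subr0.
apply/negP; rewrite -ltNge; apply: le_lt_trans lt.
by rewrite ler_wpM2l// lerDr.
Qed.

Lemma ann_cof H : cof (ann H).
Proof. by split; [exact: ann_fin_codim|exact: ann_closed]. Qed.

End Annihilators.

(** * The weak* topology *)

Section WeakStar.
Context {R : realType} {X : normedModType R}.
Implicit Types (f g : dual X) (x y : X) (H : seq X) (A W : set (dual X)).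

Definition wball g H (eta : R) : set (dual X) :=
  [set f | forall x, x \in H -> `|f x - g x : R| < eta].

Lemma wball_center g H (eta : R) : 0 < eta -> wball g H eta g.
Proof. by move=> eta0 x _; rewrite subrr normr0. Qed.

Lemma wball_half g g' H (eta : R) :
  wball g H (eta / 2) g' -> wball g' H (eta / 2) `<=` wball g H eta.
Proof.
move=> gg' f fg' x xH.
have -> : f x - g x = (f x - g' x) + (g' x - g x) :> R by rewrite addrA subrK.
apply: le_lt_trans (ler_normD _ _) _.
by rewrite [ltRHS]splitr ltrD ?fg' ?gg'.
Qed.

Lemma ptws_nbhs_finite (h : {ptws X -> R^o}) H (eta : R) : 0 < eta ->
  nbhs h [set k : {ptws X -> R^o} |
          forall x, x \in H -> `|k x - h x : R| < eta].
Proof.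
move=> eta0; elim: H => [|x H IH].
  by apply: filterS filterT => k _ x; rewrite in_nil.
have near_x : nbhs h [set k : {ptws X -> R^o} | `|k x - h x : R| < eta].
  have /(_ h) := @proj_continuous X (fun=> R^o) x.
  move=> /(_ [set r : R^o | `|r - h x| < eta]); apply.
  have := @nbhsx_ballx R R^o (h x) eta eta0.
  by apply: filterS => r; rewrite -ball_normE /= distrC.
apply: filterS (filterI near_x IH) => k [kx kH] y.
by rewrite inE => /predU1P[->//|/kH].
Qed.

Lemma weak_star_closed_wball W g : weak_star_closed W -> ~ W g ->
  exists H, exists2 eta : R, 0 < eta & forall f, wball g H eta f -> ~ W f.
Proof.
move=> clW nWg; apply: contrapT => nball; apply/nWg/clW => V [_ [[B oB <-] Bg BV]].
pose D : set (seq X * R) := [set p | 0 < p.2].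
pose N (p : seq X * R) := [set k : {ptws X -> R^o} |
  forall x, x \in p.1 -> `|k x - g x : R| < p.2].
have FF : Filter (filter_from D N).
  apply: filter_from_filter; first by exists ([::], 1); rewrite /D/=.
  move=> [H e] [H' e'] /= e0 e'0; exists (H ++ H', Num.min e e').
    by rewrite /D /= lt_min e0.
  move=> k kH; split=> x xH; have := kH x; rewrite mem_cat xH ?orbT => /(_ isT).
    by rewrite lt_min => /andP[].
  by rewrite lt_min => /andP[].
have cvgN : {ptws, filter_from D N --> (g : X -> R^o)}.
  apply/pointwise_cvgP => x; apply/cvgrPdist_lt => e e0.
  exists ([:: x], e) => //= k /(_ x); rewrite mem_head distrC; exact.
have [[H e] /= e0 NB] : filter_from D N B.
  by apply: cvgN; exact: open_nbhs_nbhs.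
have [f [fN fW]] : exists f, wball g H e f /\ W f.
  apply: contrapT => nf; apply: nball; exists H, e => // f fH Wf.
  by apply: nf; exists f.
by exists f; split => //; apply: BV; apply: NB.
Qed.

(** Compactness for the weak* topology, in terms of covers by basic
    neighbourhoods, one around each point. *)
Definition wcompact A := forall (H : dual X -> seq X) (eta : dual X -> R),
  (forall g, 0 < eta g) ->
  exists2 s : seq (dual X), (forall g, g \in s -> A g) &
    forall f, A f -> exists2 g, g \in s & wball g (H g) (eta g) f.

Lemma functional_of_bound (h : X -> R^o) :
  (forall (a : R) x y, h (a *: x + y) = a * h x + h y) ->
  (forall x, `|h x : R| <= `|x|) ->
  exists2 f : dual X, (f : X -> R^o) = h & `|f| <= 1.
Proof.
move=> hlin hle; have ch : continuous h.
  move=> x; apply/cvgrPdist_lt => e e0; near=> y.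
  have -> : h x - h y = h (x - y) :> R.
    by have := hlin (-1) y x; rewrite mulN1r scaleN1r addrC => ->; rewrite addrC.
  apply: le_lt_trans (hle _) _; near: y; exact: cvgr_dist_lt.
have hP : h \in @is_functional R X by apply/asboolP.
exists (Dual hP) => //; apply: dual_norm_le => x x1.
exact: le_trans (hle x) x1.
Unshelve. all: by end_near. Qed.

(** A filter on the ball that avoids every finite union of the given
    neighbourhoods clusters, by Tychonoff's theorem, at a function that is
    a pointwise limit of functionals of the ball. *)
Lemma ball_wcompact : wcompact [set f | `|f| <= 1].
Proof.
move=> H eta eta0; apply: contrapT => nocover.
set B := [set f : dual X | `|f| <= 1].
pose D : set (seq (dual X)) := [set s : seq (dual X) | forall g, g \in s -> B g].
pose N (s : seq (dual X)) : set {ptws X -> R^o} := @dual_fun R X @`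
  [set f | B f /\ forall g, g \in s -> ~ wball g (H g) (eta g) f].
have PF : ProperFilter (filter_from D N).
  apply: filter_from_proper; last first.
    move=> s Ds; apply: contrapT => emp; apply: nocover; exists s => // f Bf.
    apply: contrapT => nf; apply: emp; exists f, f => //; split=> // g gs gf.
    by apply: nf; exists g.
  apply: filter_from_filter; first by exists [::] => g; rewrite in_nil.
  move=> s s' Ds Ds'; exists (s ++ s').
    by move=> g; rewrite mem_cat => /orP[/Ds|/Ds'].
  move=> _ [f [Bf nf] <-]; split; exists f => //; split=> // g gs;
    by apply: nf; rewrite mem_cat gs ?orbT.
pose K := [set h : {ptws X -> R^o} | forall x, [set r : R^o | `|r| <= `|x|] (h x)].
have cK : compact K.
  apply: (@tychonoff X (fun=> R^o) (fun x => [set r | `|r| <= `|x|])) => x.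
  rewrite (_ : [set r | _] = `[- `|x|, `|x|]%classic); last first.
    by apply/seteqP; split=> r /=; rewrite in_itv /= ler_norml.
  exact: segment_compact.
have FK : filter_from D N K.
  exists [::]; first by move=> g; rewrite in_nil.
  move=> _ [f [Bf _] <-] x /=; apply: le_trans (dual_apply_le _ _) _.
  by rewrite ler_piMl.
have [h [Kh clh]] := cK _ PF FK.
have close s (L : seq X) (e : R) : D s -> 0 < e -> exists f, [/\ B f,
    (forall g, g \in s -> ~ wball g (H g) (eta g) f) &
    forall x, x \in L -> `|f x - h x : R| < e].
  move=> Ds e0; have Fs : filter_from D N (N s) by exists s.
  have [_ [[f [Bf nf] <-] fh]] := clh _ _ Fs (ptws_nbhs_finite h L e0).
  by exists f.
have D0 : D [::] by move=> g; rewrite in_nil.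
have hlin (a : R) x y : h (a *: x + y) = a * h x + h y :> R.
  apply/eqP; rewrite -subr_eq0 -normr_eq0 eq_le normr_ge0 andbT.
  apply/ler_addgt0Pl => e e0; rewrite addr0.
  have k0 : 0 < `|a| + 2 by rewrite ltr_wpDl.
  have [f [_ _ fh]] := close _ [:: x; y; a *: x + y] (e / (`|a| + 2)) D0
    (divr_gt0 e0 k0).
  have := fh x; have := fh y; have := fh (a *: x + y).
  rewrite !inE !eqxx ?orbT => /(_ isT) h1 /(_ isT) h2 /(_ isT) h3.
  have -> : h (a *: x + y) - (a * h x + h y) =
      a * (f x - h x) + (f y - h y) - (f (a *: x + y) - h (a *: x + y)) :> R.
    by rewrite dual_addE dual_scaleE; ring.
  have -> : e = `|a| * (e / (`|a| + 2)) + e / (`|a| + 2) + e / (`|a| + 2).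
    by field; rewrite gt_eqF.
  apply: le_trans (ler_normB _ _) _; apply: lerD; last exact: ltW.
  apply: le_trans (ler_normD _ _) _; apply: lerD; last exact: ltW.
  by rewrite normrM ler_wpM2l// ltW.
have [g gh Bg] := functional_of_bound hlin Kh.
have Dg : D [:: g] by move=> k; rewrite inE => /eqP ->.
have [f [_ nf fh]] := close _ (H g) _ Dg (eta0 g).
apply: (nf g) => [|x xH]; first by rewrite mem_head.
by have := fh x xH; rewrite -gh.
Qed.

Lemma wcompact_closed_sub A A' : wcompact A -> A' `<=` A ->
  (forall g, A g -> ~ A' g ->
    exists H, exists2 eta : R, 0 < eta & forall f, wball g H eta f -> ~ A' f) ->
  wcompact A'.
Proof.
move=> cA sub sep H eta eta0.
have /choice[p pP] : forall g, exists p : seq X * R, [/\ 0 < p.2,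
    A' g -> p = (H g, eta g) &
    A g -> ~ A' g -> forall f, wball g p.1 p.2 f -> ~ A' f].
  move=> g; have [A'g|nA'g] := pselect (A' g).
    by exists (H g, eta g); split=> [||_ /(_ A'g)] //; exact: eta0.
  have [Ag|nAg] := pselect (A g); last by exists ([::], 1); split.
  by have [L [e e0 Le]] := sep g Ag nA'g; exists (L, e).
have [|s sA scov] := cA (fun g => (p g).1) (fun g => (p g).2).
  by move=> g; have [] := pP g.
exists [seq g <- s | g \in A'].
  by move=> g; rewrite mem_filter => /andP[/set_mem].
move=> f A'f; have [g gs gf] := scov f (sub _ A'f).
have [_ pin pout] := pP g.
have [A'g|nA'g] := pselect (A' g); last by case: (pout (sA _ gs) nA'g _ gf).
exists g; first by rewrite mem_filter gs mem_set.
by have pg := pin A'g; rewrite pg in gf.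
Qed.

End WeakStar.

(** * Finite nets *)

Section Nets.
Context {R : realType}.

(** Each [P i] is a cell; [s] contains a representative in [S] of every cell
    with index in [q] that meets [S]. *)
Lemma finite_reps (I T : eqType) (S : set T) (P : I -> set T) (q : seq I) :
  exists2 s : seq T, (forall w, w \in s -> S w) &
    forall w i, S w -> i \in q -> P i w -> exists2 w', w' \in s & P i w'.
Proof.
elim: q => [|i q [s sS sP]].
  by exists [::].
have [[w Sw Pw]|no] := pselect (exists2 w, S w & P i w).
  exists (w :: s) => [v|v j Sv].
    by rewrite inE => /predU1P[->//|/sS].
  rewrite inE => /predU1P[-> _|jq Pv]; first by exists w; rewrite ?mem_head.
  by have [w' w's Pw'] := sP v j Sv jq Pv; exists w'; rewrite // inE w's orbT.
exists s => // v j Sv; rewrite inE => /predU1P[-> Pv|]; last exact: sP.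
by case: no; exists v.
Qed.

Lemma finite_grid (M e : R) : 0 < e ->
  exists q : seq R, forall r, `|r| <= M -> exists2 a, a \in q & `|r - a| <= e.
Proof.
move=> e0; have [n Mn] : exists n : nat, M <= n%:R * e.
  exists (Num.truncn (`|M| / e)).+1; rewrite -ler_pdivrMr//.
  apply: le_trans (ltW (truncnS_gt _)).
  by rewrite ler_wpM2r// ?invr_ge0 ?(ltW e0)// ler_norm.
have [q qP] : exists q : seq R, forall r, `|r| <= n%:R * e ->
    exists2 a, a \in q & `|r - a| <= e.
  elim: n {Mn} => [|n [q qP]].
    exists [:: 0] => r; rewrite mul0r normr_le0 => /eqP ->.
    by exists 0; rewrite ?mem_head// subrr normr0 ltW.
  exists [:: n%:R * e, - (n%:R * e) & q] => r rn.
  have [|lt] := leP `|r| (n%:R * e).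
    by move=> /qP[a aq ra]; exists a; rewrite // !inE aq !orbT.
  move: rn lt; rewrite -natr1; set t := n%:R * e; have -> : (n%:R + 1) * e = t + e.
    by rewrite mulrDl mul1r.
  have [r0|r0] := ger0P r => rn lt.
    exists t; rewrite ?mem_head//; rewrite ger0_norm; lra.
  exists (- t); rewrite ?inE ?eqxx ?orbT//; rewrite ler0_norm; lra.
by exists q => r rM; apply: qP; exact: le_trans rM Mn.
Qed.

Lemma functional_net {X : normedModType R} (F : seq (dual X)) (eta : R) (S : set X) :
  0 < eta -> (forall y, S y -> `|y| <= 1) ->
  exists2 s : seq X, (forall y, y \in s -> S y) &
    forall y, S y -> exists2 y', y' \in s &
      forall f, f \in F -> `|f (y - y') : R| <= eta.
Proof.
move=> eta0; elim: F S => [|f F IH] S S1.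
  have [[y Sy]|no] := pselect (exists y, S y).
    exists [:: y] => [z|z _]; first by rewrite inE => /eqP ->.
    by exists y; rewrite ?mem_head.
  by exists [::] => // y Sy; case: no; exists y.
have [|q qP] := @finite_grid `|f| (eta / 2); first by rewrite divr_gt0.
pose S_ a := [set y | S y /\ `|f y - a : R| <= eta / 2].
have /choice[s_ s_P] : forall a, exists s : seq X, (forall y, y \in s -> S_ a y) /\
    forall y, S_ a y -> exists2 y', y' \in s &
      forall f, f \in F -> `|f (y - y') : R| <= eta.
  by move=> a; have [|s ? ?] := IH (S_ a); [move=> y [/S1]|exists s].
exists (flatten [seq s_ a | a <- q]) => [y /flatten_mapP[a aq ya]|y Sy].
  by have [/(_ _ ya)[]] := s_P a.
have [a aq ya] := qP _ (dual_apply_le1 f (S1 _ Sy)).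
have [sS /(_ y)[//|y' y's yy']] := s_P a.
exists y'; first by apply/flatten_mapP; exists a.
move=> g; rewrite inE => /predU1P[->|/yy'//]; rewrite dual_subE.
have -> : f y - f y' = (f y - a) - (f y' - a) :> R by ring.
apply: le_trans (ler_normB _ _) _; rewrite [leRHS]splitr lerD//.
by have [] := sS _ y's.
Qed.

(** Bounded sets are totally bounded modulo a subspace of finite
    codimension.  The induction adds one spanning vector [e] at a time: either
    [e] is a limit of elements of the subspace and is negligible, or it stays
    at a positive distance from it, which bounds its coefficients. *)
Lemma finite_codim_net {Z : normedModType R} (n : nat) (Y : set Z)
    (e : 'I_n -> Z) (S : set Z) (M eta : R) :
  0 < eta -> Y 0 -> (forall (a : R) u v, Y u -> Y v -> Y (a *: u + v)) ->
  (forall z, exists a : 'I_n -> R, Y (z - \sum_(i < n) a i *: e i)) ->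
  (forall z, S z -> `|z| <= M) ->
  exists2 s : seq Z, (forall w, w \in s -> S w) &
    forall w, S w -> exists2 w', w' \in s &
      exists2 y, Y y & `|w - w' - y| <= eta.
Proof.
elim: n Y e S eta => [|n IH] Y e S eta eta0 Y0 Ylin Yspan SM.
  have [[w Sw]|no] := pselect (exists w, S w); last first.
    by exists [::] => // w Sw; case: no; exists w.
  exists [:: w] => [z|z _]; first by rewrite inE => /eqP ->.
  exists w; rewrite ?mem_head//; exists (z - w); last by rewrite subrr normr0 ltW.
  by have [a] := Yspan (z - w); rewrite big_ord0 subr0.
pose e0 := e ord0; pose Y1 := [set z | exists a : R, Y (z - a *: e0)].
have eta4 : 0 < eta / 4 by rewrite divr_gt0.
have [|a u v [b Yu] [c Yv]|z||s1 s1S s1P] :=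
    IH Y1 (fun i => e (lift ord0 i)) S (eta / 4) eta4.
- by exists 0; rewrite scale0r subr0.
- exists (a * b + c); have := Ylin a _ _ Yu Yv.
  rewrite scalerDl scalerBr scalerA; congr Y.
  by rewrite opprD addrACA.
- have [a Ya] := Yspan z; exists (fun i => a (lift ord0 i)), (a ord0).
  by move: Ya; rewrite big_ord_recl opprD addrA addrAC.
- exact: SM.
have [limit|] := pselect (forall rho : R, 0 < rho -> exists2 y, Y y & `|e0 - y| <= rho).
  exists s1 => // w /s1P[w' w's [y1 [a Ya] wy1]]; exists w' => //.
  have a1 : 0 < `|a| + 1 by rewrite ltr_wpDl.
  have [|y Yy ey] := limit (eta / 4 / (`|a| + 1)); first by rewrite divr_gt0.
  exists (a *: y + (y1 - a *: e0)); first exact: Ylin.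
  have -> : w - w' - (a *: y + (y1 - a *: e0)) = (w - w' - y1) + a *: (e0 - y).
    rewrite scalerBr opprD opprB -[RHS]addrA; congr (_ + _).
    by rewrite addrCA [RHS]addrCA; congr (_ + _); exact: addrC.
  apply: le_trans (ler_normD _ _) _.
  have : `|a *: (e0 - y)| <= eta / 4.
    rewrite normrZ -[leRHS](@divfK _ (`|a| + 1)) ?gt_eqF// mulrC.
    by rewrite ler_pM// lerDl.
  lra.
move=> /existsNP[d /not_implyP[d0 far]].
have e1 : 0 < `|e0| + 1 by rewrite ltr_wpDl.
have [|q qP] := @finite_grid ((M + M + eta) / d) (eta / 4 / (`|e0| + 1)).
  by rewrite !divr_gt0.
pose P (p : Z * R) := [set w | exists2 y, Y y &
  `|w - p.1 - (y + p.2 *: e0)| <= eta / 2].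
have [s sS sP] := finite_reps S P [seq (w, a) | w <- s1, a <- q].
exists s => // w Sw; have [w' w's [y1 [a Ya] wy1]] := s1P w Sw.
have y1M : `|y1| <= M + M + eta.
  have -> : y1 = (w - w') - (w - w' - y1) by rewrite opprB addrC subrK.
  apply: le_trans (ler_normB _ _) _; apply: lerD; last by lra.
  by apply: le_trans (ler_normB _ _) _; apply: lerD; apply: SM => //; exact: s1S.
have aM : `|a| <= (M + M + eta) / d.
  rewrite ler_pdivlMr//; apply: le_trans y1M.
  have [->|a0] := eqVneq a 0; first by rewrite normr0 mul0r.
  have -> : y1 = a *: (e0 - (- a^-1) *: (y1 - a *: e0)).
    rewrite scaleNr opprK scalerDr scalerA mulfV// scale1r.
    by rewrite addrC subrK.
  rewrite normrZ ler_wpM2l// leNgt; apply/negP => lt; apply: far.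
  exists (- a^-1 *: (y1 - a *: e0)); last exact: ltW.
  by have := Ylin (- a^-1) _ _ Ya Y0; rewrite addr0.
have [b bq ab] := qP a aM.
have [y Yy wy] : P (w', b) w.
  exists (y1 - a *: e0) => //=.
  have -> : w - w' - (y1 - a *: e0 + b *: e0) = (w - w' - y1) + (a - b) *: e0.
    rewrite scalerBl opprD opprB -[RHS]addrA; congr (_ + _).
    by rewrite addrAC addrC.
  apply: le_trans (ler_normD _ _) _.
  have : `|(a - b) *: e0| <= eta / 4.
    rewrite normrZ -[leRHS](@divfK _ (`|e0| + 1)) ?gt_eqF//.
    by rewrite ler_pM// lerDl.
  lra.
have [||w'' w''s [y'' Yy'' wy'']] := sP w (w', b) Sw.
- by apply/allpairsP; exists (w', b).
- by exists y.
exists w'' => //; exists (y - y'').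
  by rewrite addrC -scaleN1r; exact: Ylin.
have -> : w - w'' - (y - y'') =
    (w - w' - (y + b *: e0)) - (w'' - w' - (y'' + b *: e0)).
  have shift (u v t : Z) : (u + t) - (v + t) = u - v.
    by rewrite opprD addrACA subrr addr0.
  have swap (p1 p2 p3 p4 : Z) : (p1 - p2) - (p3 - p4) = (p1 - p3) - (p2 - p4).
    by rewrite !opprD !opprK addrACA.
  by rewrite [RHS]swap !shift.
apply: le_trans (ler_normB _ _) _.
by rewrite [leRHS]splitr lerD.
Qed.

(** If every finite annihilator left [W], one could pick functionals, each in
    the annihilator of a set that separates all the previous ones from [W];
    they would be linearly independent modulo [W]. *)
Lemma cof_weak_star_ann {X : normedModType R} (W : set (dual X)) :
  cof_weak_star W -> exists H, ann H `<=` W.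
Proof.
move=> [[W0 Wlin [d [e espan]]] clW]; apply: contrapT => /forallNP noH.
have pick H : exists2 u, ann H u & ~ W u.
  apply: contrapT => nu; apply: (noH H) => u uH.
  by apply: contrapT => nWu; apply: nu; exists u.
have indep n : exists H (s : nat -> dual X), forall (c : nat -> R) v, ann H v ->
    W (\sum_(i < n) c i *: s i + v) -> forall i, (i < n)%N -> c i = 0.
  elim: n => [|n [H [s sP]]]; first by exists [::], (fun=> 0).
  have [u uH nWu] := pick H.
  have [H' [eta eta0 sep]] := weak_star_closed_wball clW nWu.
  exists (H ++ H'), (fun i => if i == n then u else s i) => c v /ann_cat[vH vH'].
  rewrite big_ord_recr /= eqxx.
  under eq_bigr => i _ do rewrite ltn_eqF//.
  rewrite -addrA => Wsum.
  have c0 : forall i, (i < n)%N -> c i = 0 by apply: sP Wsum; exact: annP.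
  have cn0 : c n = 0.
    apply: contrapT => /eqP cn; move: Wsum; rewrite big1 ?add0r => [Wcn|i _].
      apply: (sep (u + (c n)^-1 *: v)) => [x xH|].
        by rewrite dualDE dualZE vH'// mulr0 addr0 subrr normr0.
      have := Wlin (c n)^-1 _ _ Wcn W0.
      by rewrite addr0 scalerDr scalerA mulVf// scale1r.
    by rewrite c0// scale0r.
  by move=> i; rewrite ltnS leq_eqVlt => /predU1P[->|/c0].
have [H [s sP]] := indep d.+1.
have /choice[a aP] : forall i : 'I_d.+1, exists a : 'I_d -> R,
    W (s i - \sum_(j < d) a j *: e j) by move=> i; exact: espan.
pose A := \matrix_(i < d.+1, j < d) a i j.
have : kermx A != 0.
  rewrite -mxrank_eq0 mxrank_ker subn_eq0 -ltnNge.
  by rewrite ltnS rank_leq_col.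
case/rowV0Pn => c /sub_kermxP cA c0.
have Wsum (I : finType) (b : I -> R) (t : I -> dual X) :
    (forall i, W (t i)) -> W (\sum_i b i *: t i).
  move=> Wt; elim/big_ind: _ => // [u v Wu Wv|i _].
    by have := Wlin 1 _ _ Wu Wv; rewrite scale1r.
  by have := Wlin (b i) _ _ (Wt i) W0; rewrite addr0.
have Wc : W (\sum_(i < d.+1) c 0 i *: s i + 0).
  have := Wsum _ (c 0) _ aP; congr W; rewrite addr0.
  under eq_bigr do rewrite scalerBr.
  rewrite sumrB -[RHS]subr0; congr (_ - _).
  under eq_bigr do rewrite scaler_sumr.
  rewrite exchange_big big1// => j _.
  under eq_bigr do rewrite scalerA.
  rewrite -scaler_suml; have /matrixP/(_ 0 j) := cA; rewrite !mxE.
  by under eq_bigr do rewrite mxE; move=> ->; rewrite scale0r.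
move/eqP: c0; apply; apply/rowP => i; rewrite mxE.
pose c' (k : nat) := if insub k is Some j then c 0 j else 0.
have cE (j : 'I_d.+1) : c 0 j = c' j by rewrite /c' valK.
rewrite cE; apply: (sP c' 0) => //.
by under eq_bigr do rewrite -cE.
Qed.

End Nets.

(** * Asymptotic midpoint uniform convexity along the weak* topology *)

Section EquivalentNorms.
Context {R : realType} {Z : normedModType R}.
Implicit Types (N : Z -> R) (Y : set Z).

Lemma inf_sup_inf_gt0 N (Q : Z -> Z -> R) :
  (0 < ereal_inf [set ereal_sup [set
        ereal_inf [set (Q z y)%:E | y in Y `&` unit_sphere N]
      | Y in @cof R Z] | z in unit_sphere N])%E <->
  exists2 d : R, 0 < d & forall z, N z = 1 ->
    exists2 Y, cof Y & forall y, Y y -> N y = 1 -> d <= Q z y.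
Proof.
set inner := fun z Y => ereal_inf [set (Q z y)%:E | y in Y `&` unit_sphere N].
set I := ereal_inf _; split=> [I0|[d d0 dP]].
  have [d d0 dI] : exists2 d : R, 0 < d & (d%:E < I)%E.
    case: I I0 => [r| |//]; last by exists 1; rewrite ?ltry.
    by rewrite lte_fin => r0; exists (r / 2); rewrite ?lte_fin; lra.
  exists d => // z Nz.
  have : (d%:E < ereal_sup [set inner z Y | Y in @cof R Z])%E.
    by apply: lt_le_trans dI _; apply: ereal_inf_lbound; exists z.
  move=> /ereal_sup_gt[_ [Y cY <-] dY]; exists Y => // y Yy Ny.
  rewrite -lee_fin; apply: le_trans (ltW dY) _.
  by apply: ereal_inf_lbound; exists y.
apply: (@lt_le_trans _ _ d%:E); first by rewrite lte_fin.
apply: le_ereal_inf_tmp => _ [z Nz <-]; have [Y cY YP] := dP z Nz.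
apply: (@le_trans _ _ (inner z Y)); last by apply: ereal_sup_ubound; exists Y.
by apply: le_ereal_inf_tmp => _ [y [Yy Ny] <-]; rewrite lee_fin; exact: YP.
Qed.

Variables (N : Z -> R) (hN : is_equivalent_norm N).

Let ND := eqnorm_triangle hN.
Let NZ := eqnorm_homogeneous hN.

Lemma eqnorm0 : N 0 = 0.
Proof. by rewrite -(scale0r 0) NZ normr0 mul0r. Qed.

Lemma eqnormN x : N (- x) = N x.
Proof. by rewrite -scaleN1r NZ normrN1 mul1r. Qed.

Lemma eqnormB x y : N (x - y) <= N x + N y.
Proof. by rewrite -(eqnormN y) ND. Qed.

Lemma eqnorm_unit x : 0 < N x -> N ((N x)^-1 *: x) = 1.
Proof.
by move=> x0; rewrite NZ ger0_norm ?invr_ge0 ?ltW// mulVf// gt_eqF.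
Qed.

Definition pm_max z w := Num.max (N (z + w)) (N (z - w)).

Lemma pm_max_convex z (a : R) w w' : 0 <= a <= 1 ->
  pm_max z (a *: w + (1 - a) *: w') <= Num.max (pm_max z w) (pm_max z w').
Proof.
move=> /andP[a0 a1].
have comb u v : N (a *: u + (1 - a) *: v) <= Num.max (N u) (N v).
  apply: le_trans (ND _ _) _; rewrite !NZ !ger0_norm ?subr_ge0//.
  apply: (@le_trans _ _ (a * Num.max (N u) (N v) + (1 - a) * Num.max (N u) (N v))).
    by rewrite lerD// ler_wpM2l ?subr_ge0// le_max lexx ?orbT.
  by rewrite -mulrDl addrC subrK mul1r.
have split_z u v : z + (a *: u + (1 - a) *: v) = a *: (z + u) + (1 - a) *: (z + v).
  by rewrite !scalerDr [RHS]addrACA -scalerDl [a + _]addrC subrK scale1r.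
rewrite /pm_max opprD -!scalerN !split_z ge_max; apply/andP.
by split; apply: le_trans (comb _ _) _; rewrite !ge_max !le_max !lexx ?orbT.
Qed.

Lemma pm_maxN z w : pm_max z (- w) = pm_max z w.
Proof. by rewrite /pm_max opprK maxC. Qed.

Lemma pm_max_scale z (a : R) w : 0 <= a <= 1 -> pm_max z (a *: w) <= pm_max z w.
Proof.
move=> a01; have := @pm_max_convex z ((1 + a) / 2) w (- w).
rewrite pm_maxN maxxx scalerN -scalerBl.
have -> : (1 + a) / 2 - (1 - (1 + a) / 2) = a by field.
by apply; move: a01; lra.
Qed.

Lemma pm_max_ge z w : N z <= pm_max z w.
Proof.
have := @pm_max_scale z 0 w; rewrite lexx ler01 => /(_ isT).
by rewrite scale0r /pm_max addr0 subr0 maxxx.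
Qed.

Lemma pm_max_ge_tail z w : N w <= pm_max z w.
Proof.
have := eqnormB (z + w) (z - w).
have -> : (z + w) - (z - w) = (2 : R) *: w.
  by rewrite opprB addrCA addrAC subrr add0r scaler_nat mulr2n.
rewrite NZ ger0_norm// /pm_max => le2.
by have [] := lerP (N (z + w)) (N (z - w)); lra.
Qed.

Lemma pm_max_perturb z w w' : pm_max z w <= pm_max z w' + N (w - w').
Proof.
rewrite /pm_max ge_max; apply/andP; split.
  have -> : z + w = (z + w') + (w - w') by rewrite addrA addrAC addrK.
  by apply: le_trans (ND _ _) _; rewrite lerD2r le_max lexx.
have -> : z - w = (z - w') - (w - w') by rewrite opprB addrA subrK.
by apply: le_trans (eqnormB _ _) _; rewrite lerD2r le_max lexx orbT.
Qed.

End EquivalentNorms.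

Section WeakStarGrowth.
Context {R : realType} {X : normedModType R}.
Variables (N : dual X -> R) (hN : is_equivalent_norm N).

(** The subspaces in the definition of [AMUC] are only norm closed, so a
    weak* small perturbation [w] need not be close to them.  Half a difference
    [w - w'] of two perturbations can be: modulo such a subspace, bounded
    perturbations fall into finitely many small cells, and [w'] is taken in the
    cell of [w].  That [w] annihilates vectors that almost norm the
    representatives [w'] of the cells keeps [w - w'] large.  By convexity, if
    neither sign of [w] and [w'] increases the norm of [z] by much, then
    neither does any sign of half their difference, against [AMUC]. *)
Lemma AMUC_ann : AMUC N -> forall t : R, 0 < t -> exists2 d : R, 0 < d &
  forall z, N z = 1 -> exists H : seq X, forall w, ann H w -> t <= N w ->
    1 + d <= pm_max N z w.
Proof.
move=> amucN t t0; have [c [C [c0 C0 cC]]] := eqnorm_bounds hN.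
have NZ := eqnorm_homogeneous hN.
pose t1 := c * t / (4 * C).
have t10 : 0 < t1 by rewrite divr_gt0 ?mulr_gt0.
have [|d0 d00 dP] := (inf_sup_inf_gt0 N _).1 (amucN (t1 / 2) _).
  by rewrite divr_gt0.
exists (d0 / 2); first by rewrite divr_gt0.
move=> z Nz; apply: contrapT => /forallNP bad.
have [Y [[Y0 Ylin [n [e espan]]] _] YP] := dP z Nz.
pose S := [set w | N w = t /\ pm_max N z w < 1 + d0 / 2].
have SH H : exists2 w, ann H w & S w.
  have /existsNP[w /not_implyP[wH /not_implyP[tw /negP]]] := bad H.
  rewrite -ltNge => lt; have w0 : 0 < N w := lt_le_trans t0 tw.
  exists ((t / N w) *: w); first exact: annZ.
  have tw01 : 0 <= t / N w <= 1.
    by rewrite divr_ge0 ?(ltW t0) ?(ltW w0)//= ler_pdivrMr// mul1r.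
  split; last exact: le_lt_trans (pm_max_scale hN _ _ tw01) lt.
  rewrite NZ ger0_norm ?divfK ?gt_eqF//.
  by case/andP: tw01.
pose m := Num.min (t1 / 2) (d0 / 2).
have m0 : 0 < m by rewrite lt_min; apply/andP; split; apply: divr_gt0.
have [|||||s sS sP] := @finite_codim_net R (dual X) n Y e S (t / c) (2 * m / C).
- by rewrite divr_gt0 ?mulr_gt0.
- exact: Y0.
- exact: Ylin.
- exact: espan.
- move=> w [Nw _]; rewrite ler_pdivlMr// -Nw mulrC.
  by case/andP: (cC w).
have /choice[x xP] := @dual_half_norming R X.
have [w wH Sw] := SH [seq x w' | w' <- s].
have [w' w's [y Yy wy]] := sP w Sw.
have [Nw' pm'] := sS _ w's; have [Nw pm] := Sw.
pose u := (2^-1 : R) *: (w - w').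
have pmu : pm_max N z u < 1 + d0 / 2.
  have -> : u = (2^-1 : R) *: w + (1 - 2^-1) *: (- w').
    have -> : 1 - 2^-1 = 2^-1 :> R by field.
    by rewrite -scalerDr.
  apply: le_lt_trans (pm_max_convex hN _ _ _ _) _; first by lra.
  by rewrite pm_maxN gt_max pm.
have Nu : t1 <= N u.
  have wx : w (x w') = 0 by apply: wH; exact: map_f.
  have [x1 half] := xP w'.
  have ww' : `|w'| / 2 <= `|w - w'|.
    apply: le_trans half _; apply: le_trans (dual_apply_le1 (w - w') x1).
    by rewrite dualBE wx sub0r normrN ler_norm.
  have tC : t / C <= `|w'|.
    by rewrite ler_pdivrMr// -Nw' mulrC; case/andP: (cC w').
  have : c * `|w - w'| <= N (w - w') by case/andP: (cC (w - w')).
  rewrite NZ ger0_norm// => cN.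
  have -> : t1 = 2^-1 * (c * (t / C / 2)) by rewrite /t1; field; rewrite gt_eqF.
  rewrite ler_pM2l//; apply: le_trans cN; rewrite ler_pM2l//; lra.
have Nuy : N (u - (2^-1 : R) *: y) <= m.
  rewrite -scalerBr NZ ger0_norm//.
  have /andP[_ le] := cC (w - w' - y).
  have := le_trans le (ler_wpM2l (ltW C0) wy).
  by rewrite [_ * (_ / C)]mulrC divfK ?gt_eqF//; lra.
have [m1 m2] : m <= t1 / 2 /\ m <= d0 / 2.
  by apply/andP; rewrite -le_min.
pose v := (2^-1 : R) *: y.
have Nv : t1 / 2 <= N v.
  have := eqnorm_triangle hN (u - v) v; rewrite subrK; lra.
have Nv0 : 0 < N v by apply: lt_le_trans Nv; rewrite divr_gt0.
have Yv : Y ((N v)^-1 *: v).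
  have := Ylin ((N v)^-1 * 2^-1) _ _ Yy Y0.
  by rewrite addr0 /v scalerA.
have := YP _ Yv (eqnorm_unit hN Nv0).
rewrite scalerA -/(pm_max N z _) leNgt => /negP; apply.
have : pm_max N z (((t1 / 2) * (N v)^-1) *: v) <= pm_max N z v.
  apply: pm_max_scale => //; apply/andP; split.
    by apply: divr_ge0; apply: ltW => //; exact: divr_gt0.
  by rewrite ler_pdivrMr// mul1r.
have := pm_max_perturb hN z v u.
by rewrite -(eqnormN hN) opprB; lra.
Qed.

(** The additive form of [AMUC_ann].  When [N z] is small compared to [a], the
    growth comes from [N w <= pm_max N z w] alone. *)
Lemma AMUC_growth : AMUC N -> forall M a : R, 0 < M -> 0 < a ->
  exists2 k : R, 0 < k & forall z, N z <= M -> exists H : seq X,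
    forall w, ann H w -> a <= N w -> N z + k <= pm_max N z w.
Proof.
move=> amucN M a M0 a0; have NZ := eqnorm_homogeneous hN.
have [|d d0 dP] := AMUC_ann amucN (t := a / M); first by rewrite divr_gt0.
pose k := Num.min (a / 2) (d * a / 2).
have [k1 k2] : k <= a / 2 /\ k <= d * a / 2 by apply/andP; rewrite -le_min.
exists k; first by rewrite lt_min !divr_gt0 ?mulr_gt0.
move=> z zM; have [za|az] := ltP (N z) (a / 2).
  exists [::] => w _ aw; apply: le_trans (pm_max_ge_tail hN z w); lra.
have z0 : 0 < N z by apply: lt_le_trans az; rewrite divr_gt0.
have [H HP] := dP _ (eqnorm_unit hN z0); exists H => w wH aw.
have := HP _ (annZ (N z)^-1 wH).
have NzV : `|(N z)^-1| = (N z)^-1 by rewrite ger0_norm ?invr_ge0 ?ltW.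
rewrite NZ NzV.
have aM : a / M <= (N z)^-1 * N w.
  rewrite mulrC ler_pM ?invr_ge0 ?(ltW a0) ?(ltW M0)//.
  by rewrite lef_pV2 ?posrE.
move=> /(_ aM).
have -> : pm_max N ((N z)^-1 *: z) ((N z)^-1 *: w) = pm_max N z w / N z.
  rewrite /pm_max -scalerDr -scalerBr !NZ NzV maxr_pMl ?invr_ge0 ?ltW//.
  by rewrite mulrC; congr Num.max; rewrite mulrC.
rewrite ler_pdivlMr// mulrDl mul1r; apply: le_trans.
rewrite lerD2l; apply: le_trans k2 _; rewrite -mulrA ler_pM2l//.
Qed.

End WeakStarGrowth.

(** * Szlenk derivations *)

Section Szlenk.
Context {R : realType} {X : normedModType R}.
Implicit Types (f g u : dual X) (H : seq X) (A : set (dual X)).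

(** The derivation behind the Szlenk index.  Asking for two points at distance
    [eps], instead of one point far from [g], makes the derivative of a weak*
    closed set weak* closed. *)
Definition szlenk_deriv (eps : R) A : set (dual X) :=
  [set g | A g /\ forall H (eta : R), 0 < eta -> exists u v,
    [/\ A u, A v, wball g H eta u, wball g H eta v & eps <= `|u - v|]].

Definition szlenk (eps : R) (k : nat) : set (dual X) :=
  iter k (szlenk_deriv eps) [set f | `|f| <= 1].

Lemma szlenk_ball eps k f : szlenk eps k f -> `|f| <= 1.
Proof. by elim: k f => [//|k IH] f [/IH]. Qed.

Lemma szlenk_wcompact eps k : wcompact (szlenk eps k).
Proof.
elim: k => [|k IH]; first exact: ball_wcompact.
apply: wcompact_closed_sub IH _ _ => [g []//|g Ag].
move=> /not_andP[//|/existsNP[H /existsNP[eta /not_implyP[eta0 far]]]].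
exists H, (eta / 2); first by rewrite divr_gt0.
move=> f fg [_ /(_ H (eta / 2))]; rewrite divr_gt0// => /(_ isT).
move=> [u [v [Au Av fu fv uv]]]; apply: far; exists u, v.
by split=> //; exact: wball_half fg _ _.
Qed.

Lemma szlenk_deriv_far eps A g H (eta : R) : szlenk_deriv eps A g -> 0 < eta ->
  exists u, [/\ A u, wball g H eta u & eps / 2 <= `|u - g|].
Proof.
move=> [_ gA] eta0; have [u [v [Au Av gu gv uv]]] := gA H eta eta0.
have /orP[le|lt] : (eps / 2 <= `|u - g|) || (`|u - g| < eps / 2).
  by rewrite leNgt orNb.
  by exists u.
have tri : `|u - v| <= `|u - g| + `|v - g|.
  by have -> : u - v = (u - g) - (v - g); [rewrite opprB addrA subrK|exact: ler_normB].
exists v; split=> //; move: (le_trans uv tri) lt.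
by move: `|u - g| `|v - g| => p q; clear; lra.
Qed.

Definition lin_comb (c : nat -> R) (s : seq (dual X)) :=
  \sum_(i < size s) c i *: s`_i.

Lemma lin_comb_rcons c s (a : R) w :
  lin_comb (fun i => if i == size s then a else c i) (rcons s w) =
  lin_comb c s + a *: w.
Proof.
rewrite /lin_comb size_rcons big_ord_recr /= eqxx nth_rcons ltnn eqxx.
congr (_ + _); apply: eq_bigr => i _.
by rewrite nth_rcons ltn_ord ltn_eqF.
Qed.

Lemma unconditional_lin_comb C s (c c' : nat -> R) : unconditional C s ->
  (forall i, c' i = c i \/ c' i = - c i) ->
  `|lin_comb c' s| <= C * `|lin_comb c s|.
Proof.
move=> uC cc'.
have := uC (fun i => c i) (fun i => c' i != c i); congr (`|_| <= _).
apply: eq_bigr => i _; have [->|/eqP ne] := eqVneq (c' i) (c i).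
  by rewrite expr0 mul1r.
by have [//|->] := cc' i; rewrite expr1 mulN1r.
Qed.

(** Otherwise descend from a point [g] of a late derivative to the ball in
    many weak* small steps of norm at least [eps / 2].  The steps can be
    chosen within the strategy that makes them [C]-unconditional, and within
    the annihilators where the norm [N] of a signed sum grows by a fixed amount
    for one of the two signs.  The plain sum of the steps stays bounded, hence
    so do the signed sums, whereas the growth accumulates.  *)
Lemma szlenk_empty (N : dual X -> R) : is_equivalent_norm N -> AMUC N ->
  weak_star_unconditional_asymptotic_structure X ->
  forall eps : R, 0 < eps -> exists m, forall g, ~ szlenk eps m g.
Proof.
move=> hN amucN [C C1 CP] eps eps0.
have C0 : 0 < C by apply: lt_le_trans C1.
have [c0 [C' [c00 C'0 cC]]] := eqnorm_bounds hN.
pose M := C' * (C * 3) + 1.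
have M0 : 0 < M by rewrite ltr_wpDl// !mulr_ge0// ltW.
have [|k k0 kP] := AMUC_growth hN amucN M0 (a := c0 * (eps / 4)).
  by rewrite mulr_gt0// divr_gt0.
have [n nM] : exists n : nat, M <= n.+1%:R * k.
  exists (Num.truncn (M / k)); rewrite -ler_pdivrMr//.
  exact: ltW (truncnS_gt _).
exists n.+1 => g gn.
(* [s] lists the directions of the steps already made, from [g] to [u], with
   lengths [c]; [c'] are the lengths with the chosen signs, and the error on
   each step is at most [1 / n.+1]. *)
suff descent j s u (c c' : nat -> R) : szlenk eps j u ->
    asymptotic_unconditional C j s -> (size s + j = n.+1)%N ->
    (forall i, c' i = c i \/ c' i = - c i) ->
    `|lin_comb c s - (u - g)| <= (size s)%:R / n.+1%:R ->
    Num.min M ((size s)%:R * k) <= N (lin_comb c' s) -> False.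
  apply: (descent n.+1 [::] g (fun=> 0) (fun=> 0)) => //.
  - exact: CP.
  - by move=> i; left.
  - by rewrite /lin_comb big_ord0 subrr subr0 normr0 mul0r.
  - by rewrite /lin_comb big_ord0 (eqnorm0 hN) mul0r ge_min lexx orbT.
elim: j s u c c' => [|j IH] s u c c' uj sj sn cc' close large.
  rewrite addn0 in sn; move: close large; rewrite sn divff ?pnatr_eq0//.
  move=> close; rewrite min_l// => large.
  have c3 : `|lin_comb c s| <= 3.
    have -> : lin_comb c s = (lin_comb c s - (u - g)) + (u - g).
      by rewrite subrK.
    apply: le_trans (ler_normD _ _) _; have := ler_normB u g.
    have := szlenk_ball uj; have := szlenk_ball gn; lra.
  have := unconditional_lin_comb sj cc' => /le_trans/(_ (ler_wpM2l (ltW C0) c3)).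
  move=> /(ler_wpM2l (ltW C'0)); have /andP[_] := cC (lin_comb c' s).
  by move: large; rewrite /M; lra.
have [Y cY YP] := sj; have [G GY] := cof_weak_star_ann cY.
set z := lin_comb c' s in large *.
have [F FP] : exists F : seq X, forall w, ann F w -> c0 * (eps / 4) <= N w ->
    Num.min M ((size s).+1%:R * k) <= pm_max N z w.
  have [zM|Mz] := leP (N z) M.
    have [F FP] := kP z zM; exists F => w wF aw; apply: le_trans (FP w wF aw).
    move: large; rewrite !ge_min -natr1 mulrDl mul1r => /orP[Mz|large].
      by rewrite (le_trans Mz)// lerDl ltW.
    by rewrite lerD2r large orbT.
  exists [::] => w _ _; apply: le_trans (pm_max_ge hN z w).
  by rewrite ge_min ltW.
have [b b0 bP] := ann_near (G ++ F).
pose eta := Num.min (eps / 4) n.+1%:R^-1.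
have eta0 : 0 < eta by rewrite lt_min divr_gt0//= invr_gt0.
have [eta1 eta2] : eta <= eps / 4 /\ eta <= n.+1%:R^-1.
  by apply/andP; rewrite -le_min.
have [|u' [u'j uu' far]] := szlenk_deriv_far (G ++ F) uj (eta := eta / b).
  exact: divr_gt0.
have [||d /ann_cat[dG dF] du] := bP (u' - u) (eta / b).
- by rewrite divr_ge0// ltW.
- by move=> x xH; rewrite dualBE ltW ?uu'.
rewrite mulrC divfK ?gt_eqF// in du.
have d4 : eps / 4 <= `|d|.
  have : `|u' - u| <= `|u' - u - d| + `|d|.
    by apply: le_trans (ler_normD _ _); rewrite subrK.
  lra.
have d0 : 0 < `|d| by apply: lt_le_trans d4; rewrite divr_gt0.
pose w := `|d|^-1 *: d.
have dw : d = `|d| *: w by rewrite /w scalerA mulfV ?gt_eqF// scale1r.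
have w1 : `|w| = 1 by rewrite normrZ normfV normr_id mulVf// gt_eqF.
have sw := YP w (GY _ (annZ _ dG)) w1.
have Nd : c0 * (eps / 4) <= N d.
  by case/andP: (cC d) => le _; apply: le_trans le; rewrite ler_pM2l.
pose r := if N (z - d) <= N (z + d) then `|d| else - `|d|.
apply: (IH (rcons s w) u' (fun i => if i == size s then `|d| else c i)
  (fun i => if i == size s then r else c' i) u'j sw).
- by rewrite size_rcons addSnnS.
- by move=> i; case: eqP => // _; rewrite /r; case: ifP; [left|right].
- rewrite lin_comb_rcons -dw size_rcons -natr1 mulrDl mul1r.
  have -> : lin_comb c s + d - (u' - g) =
      (lin_comb c s - (u - g)) - (u' - u - d).
    rewrite [- (u' - u - d)]opprB [RHS]addrACA -opprD; congr (_ - _).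
    by rewrite [RHS]addrC addrA subrK.
  apply: le_trans (ler_normB _ _) _; apply: lerD => //.
  exact: le_trans du eta2.
- rewrite size_rcons lin_comb_rcons; apply: le_trans (FP d dF Nd) _.
  rewrite /pm_max -/z /r; have [le|/ltW le] := leP (N (z - d)) (N (z + d)).
    by rewrite -dw.
  by rewrite scaleNr -dw.
Qed.

End Szlenk.

(** * An asymptotically flat set of vectors *)

Section FlatSet.
Context {R : realType} {X : normedModType R}.
Implicit Types (f g : dual X) (x y : X) (F : seq (dual X)) (c : R).

Definition weak_nbhd F : set X :=
  [set y | `|y| <= 1 /\ forall f, f \in F -> `|f y : R| <= 1].

Lemma weak_nbhd0 F : weak_nbhd F 0.
Proof. by split=> [|f _]; rewrite ?dual_eval0 normr0 ler01. Qed.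

Lemma weak_nbhdN F y : weak_nbhd F y -> weak_nbhd F (- y).
Proof.
move=> [y1 Fy]; split=> [|f fF]; first by rewrite normrN.
by rewrite -[- y]sub0r dual_subE dual_eval0 sub0r normrN; exact: Fy.
Qed.

Lemma weak_nbhd_sub F F' : {subset F <= F'} -> weak_nbhd F' `<=` weak_nbhd F.
Proof. by move=> FF' y [y1 F'y]; split=> // f /FF'/F'y. Qed.

Lemma weak_nbhd_forall (n : nat) (P : nat -> X -> Prop) :
  (forall k, (k < n)%N -> exists F, forall y, weak_nbhd F y -> P k y) ->
  exists F, forall y, weak_nbhd F y -> forall k, (k < n)%N -> P k y.
Proof.
elim: n => [|n IH] nP; first by exists [::].
have [F FP] : exists F, forall y, weak_nbhd F y -> forall k, (k < n)%N -> P k y.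
  by apply: IH => k kn; apply: nP; exact: ltnW.
have [F' F'P] := nP n (ltnSn n).
exists (F ++ F') => y yF k; rewrite ltnS leq_eqVlt => /predU1P[->|kn].
  by apply: F'P; apply: weak_nbhd_sub yF => f; rewrite mem_cat orbC => ->.
by apply: FP kn; apply: weak_nbhd_sub yF => f; rewrite mem_cat => ->.
Qed.

(** One player chooses [k] weak neighbourhoods in turn, the other answers with
    a vector [y] of each.  In [game s k x c] the first player can keep every
    functional of the ball below [c] at [x] plus [s] times the sum of the
    answers. *)
Fixpoint game (s : R) (k : nat) x c : Prop :=
  if k is j.+1 then exists F, forall y, weak_nbhd F y -> game s j (x + s *: y) c
  else forall f, `|f| <= 1 -> f x <= c.

Lemma game_le s k x c c' : c <= c' -> game s k x c -> game s k x c'.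
Proof.
move=> cc'; elim: k x => [|k IH] x /=.
  by move=> xc f /xc fx; exact: le_trans fx cc'.
by move=> [F FP]; exists F => y /FP/IH.
Qed.

Lemma game_convex s k x x' c c' (a : R) : 0 <= a <= 1 ->
  game s k x c -> game s k x' c' ->
  game s k (a *: x + (1 - a) *: x') (a * c + (1 - a) * c').
Proof.
move=> /andP[a0 a1]; elim: k x x' => [|k IH] x x' /=.
  move=> xc xc' f f1; rewrite dual_addE !dual_scaleE.
  by rewrite lerD// ler_wpM2l ?subr_ge0 ?xc ?xc'.
move=> [F FP] [F' FP']; exists (F ++ F') => y yF.
have -> : a *: x + (1 - a) *: x' + s *: y =
    a *: (x + s *: y) + (1 - a) *: (x' + s *: y).
  by rewrite !scalerDr addrACA -[in RHS]scalerDl [a + _]addrC subrK scale1r.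
apply: IH; [apply: FP|apply: FP'];
  by apply: weak_nbhd_sub yF => f; rewrite mem_cat => ->; rewrite ?orbT.
Qed.

Lemma game_ge s k x c f : game s k x c -> `|f| <= 1 -> f x <= c.
Proof.
move=> + f1; elim: k => [|k IH] /=; first exact.
by move=> [F /(_ _ (weak_nbhd0 F))]; rewrite scaler0 addr0.
Qed.

Lemma game_norm s k x : 0 <= s -> game s k x (`|x| + k%:R * s).
Proof.
move=> s0; elim: k x => [|k IH] x /=.
  move=> f f1; rewrite mul0r addr0; apply: le_trans (ler_norm _) _.
  by apply: le_trans (dual_apply_le _ _) _; rewrite ler_piMl.
exists [::] => y [y1 _]; apply: game_le (IH _).
rewrite -natr1 mulrDl mul1r [_ * s + s]addrC addrA lerD2r.
apply: le_trans (ler_normD _ _) _; rewrite lerD2l normrZ ger0_norm//.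
by rewrite ler_piMr.
Qed.

(** Around each [g] of [A], the oscillation [f - g] has norm at most [eps],
    or at most [2] when [g] is in the derivative; the points of a finite cover
    of [A] are made negligible at [y].  *)
Lemma weak_nbhd_deriv (A : set (dual X)) (eps s rho : R) x : wcompact A ->
  (forall f, A f -> `|f| <= 1) -> 0 < s -> 0 < rho ->
  exists F, forall y, weak_nbhd F y -> forall f, A f ->
    (exists2 g, A g & f (x + s *: y) <= g x + s * eps + rho) \/
    (exists2 g, szlenk_deriv eps A g & f (x + s *: y) <= g x + 2 * s + rho).
Proof.
move=> cA A1 s0 rho0.
have rho2 : 0 < rho / 2 by rewrite divr_gt0.
have /choice[p pP] : forall g, exists p : seq X * R, [/\ 0 < p.2,
    wball g p.1 p.2 `<=` wball g [:: x] (rho / 2) &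
    A g -> ~ szlenk_deriv eps A g ->
    forall f, A f -> wball g p.1 p.2 f -> `|f - g| <= eps].
  move=> g; have [[Ag nA'g]|no] := pselect (A g /\ ~ szlenk_deriv eps A g).
    have [H [eta eta0 near]] : exists H, exists2 eta : R, 0 < eta &
        forall u v, A u -> A v -> wball g H eta u -> wball g H eta v ->
        `|u - v| < eps.
      apply: contrapT => far; apply: nA'g; split=> // H eta eta0.
      apply: contrapT => nuv; apply: far; exists H, eta => // u v Au Av gu gv.
      by rewrite ltNge; apply/negP => uv; apply: nuv; exists u, v.
    exists (x :: H, Num.min eta (rho / 2)); split=> /=.
    - by rewrite lt_min eta0.
    - move=> f fg y; rewrite inE => /eqP ->.
      by have := fg x (mem_head _ _); rewrite lt_min => /andP[].
    - move=> _ _ f Af fg; apply: ltW; apply: near => //; last exact: wball_center.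
      by move=> y yH; have := fg y; rewrite inE yH orbT lt_min => /(_ isT)/andP[].
  by exists ([:: x], rho / 2); split=> // Ag nA'g; case: no.
have [|q qA qP] := cA (fun g => (p g).1) (fun g => (p g).2).
  by move=> g; have [] := pP g.
exists [seq (2 * s / rho) *: g | g <- q] => y [y1 yq] f Af.
have [g gq fg] := qP f Af; have [_ px pA] := pP g.
have fgx : f x <= g x + rho / 2.
  have := px f fg x; rewrite mem_head => /(_ isT).
  by move=> /ltW/(le_trans (ler_norm _)); rewrite lerBlDl.
have gy : s * g y <= rho / 2.
  have := yq _ (map_f _ gq); rewrite dualZE => /(le_trans (ler_norm _)).
  rewrite mulrAC ler_pdivrMr// mul1r; lra.
have bound (b : R) : `|f - g| <= b -> f (x + s *: y) <= g x + s * b + rho.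
  move=> fgb; have : s * (f - g) y <= s * b.
    rewrite ler_pM2l//; apply: le_trans fgb; apply: le_trans (ler_norm _) _.
    exact: dual_apply_le1.
  by rewrite dualBE dual_addE dual_scaleE; lra.
have [A'g|nA'g] := pselect (szlenk_deriv eps A g).
  right; exists g => //; rewrite [2 * s]mulrC; apply: bound.
  have := ler_normB f g; have := A1 _ Af; have := A1 _ (qA _ gq); lra.
by left; exists g; [exact: qA|apply: bound; apply: pA => //; exact: qA].
Qed.

(** The potential [f x + 2 s j], for [f] in the [j]-th derivative, absorbs
    the large oscillations: each of them leads to the next derivative.  *)
Lemma game_upper (eps s : R) (m k : nat) x c : 0 < eps -> 0 < s ->
  (forall g, ~ szlenk eps m g) -> (forall f, `|f| <= 1 -> f x <= c) ->
  game s k x (c + 2 * s * m%:R + k%:R * (2 * s * eps)).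
Proof.
move=> eps0 s0 empty xc.
pose inv x c := forall j f, (j < m)%N -> szlenk eps j f -> f x + 2 * s * j%:R <= c.
have se0 : 0 < s * eps by rewrite mulr_gt0.
have inv_step z b : inv z b -> exists F, forall y, weak_nbhd F y ->
    inv (z + s *: y) (b + 2 * s * eps).
  move=> zb; pose P j y := forall f, szlenk eps j f ->
    f (z + s *: y) + 2 * s * j%:R <= b + 2 * s * eps.
  have [j jm|F FP] := @weak_nbhd_forall m P.
    have [F FP] := weak_nbhd_deriv eps z (szlenk_wcompact eps j)
      (fun f => @szlenk_ball _ _ eps j f) s0 se0.
    exists F => y /FP yP f /yP[[g gj le]|[g gj le]].
      by have := zb j g jm gj; lra.
    have j1m : (j.+1 < m)%N.
      rewrite ltn_neqAle jm andbT; apply/eqP => jE.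
      by apply: (empty g); rewrite -jE.
    by have := zb j.+1 g j1m gj; rewrite -natr1; lra.
  by exists F => y /FP yP j f jm; exact: yP.
have inv_game z b : inv z b -> game s k z (b + k%:R * (2 * s * eps)).
  elim: k z b => [|k IH] z b zb /=.
    move=> f f1; rewrite mul0r addr0.
    have m0 : (0 < m)%N by case: m empty {inv xc inv_step zb} => // /(_ f).
    by have := zb 0%N f m0 f1; rewrite mulr0 addr0.
  have [F FP] := inv_step z b zb; exists F => y /FP/IH.
  by apply: game_le; rewrite -natr1; lra.
apply: inv_game => j f jm /szlenk_ball f1; rewrite lerD ?xc//.
by rewrite ler_pM2l ?ler_nat 1?ltnW// mulr_gt0.
Qed.

(** [D] is comparable to the unit ball.  By the last condition, moving a point
    by [s] in the weakly small directions of the ball leads outside [D] by at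
    most [4 s eps], instead of the trivial order of magnitude [s]. *)
Definition flat (eps s : R) (D : set X) :=
  [/\ 0 < s <= 1, forall x, `|x| <= 1 -> D x,
    forall x f, D x -> `|f x : R| <= 2 * `|f| &
    forall x, D x -> exists F, forall y, weak_nbhd F y ->
      D ((1 + 4 * s * eps)^-1 *: (x + s *: y))].

(** The set of the [x] with [\sum_(k < n) phi_k x <= 2 n], where [phi_k x] is
    the infimum of the [c] with [game s k x c].  A step [s *: y] in a suitable
    weak neighbourhood turns [phi_(k+1)] into [phi_k], so that the sum only
    increases by [phi_n - phi_0], which is small compared to [n s].  *)
Lemma flat_set (eps : R) : 0 < eps ->
  (exists m, forall g : dual X, ~ szlenk eps m g) ->
  exists s D, flat eps s D.
Proof.
move=> eps0 [m empty].
have [n' nm] : exists n', m%:R <= n'.+1%:R * eps.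
  exists (Num.truncn (m%:R / eps)); rewrite -ler_pdivrMr//.
  exact: ltW (truncnS_gt _).
set n := n'.+1 in nm; pose s : R := n%:R^-1.
have n0 : 0 < n%:R :> R by rewrite ltr0n.
have s0 : 0 < s by rewrite invr_gt0.
have sn (k : nat) : (k <= n)%N -> k%:R * s <= 1.
  by move=> kn; rewrite ler_pdivrMr// mul1r ler_nat.
exists s, [set x | exists c : nat -> R,
  (forall k, (k < n)%N -> game s k x (c k)) /\ \sum_(k < n) c k <= 2 * n%:R].
split.
- by have := sn 1%N isT; rewrite mul1r s0.
- move=> x x1; exists (fun=> 2); split.
    move=> k /ltnW/sn ks; apply: game_le (game_norm k x (ltW s0)); lra.
  by rewrite sumr_const card_ord mulr_natr.
- move=> x f [c [cP csum]].
  have le1 g : `|g| <= 1 -> g x <= 2.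
    move=> g1; rewrite -(ler_pM2r n0); apply: le_trans csum.
    rewrite mulr_natr -[X in _ *+ X]card_ord -sumr_const.
    by apply: ler_sum => k _; apply: game_ge (cP k (ltn_ord k)) g1.
  have [->|f0] := eqVneq f 0; first by rewrite dual0E !normr0 mulr0.
  have fgt0 : 0 < `|f| by rewrite normr_gt0.
  have fu : `| `|f|^-1 *: f| <= 1.
    by rewrite normrZ normfV normr_id mulVf// gt_eqF.
  have up := le1 _ fu; rewrite dualZE mulrC ler_pdivrMr// in up.
  have := le1 (- (`|f|^-1 *: f)); rewrite normrN => /(_ fu).
  rewrite -scaleN1r !dualZE mulN1r mulrC -mulNr ler_pdivrMr// => low.
  by rewrite ler_norml up andbT lerNl.
(* Prolong [c] by a bound [c' n] for the [n]-th game, and drop the first term: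
   the shifted sequence bounds the games at [x + s *: y]. *)
move=> x [c [cP csum]].
pose c' k := if (k < n)%N then c k else c 0%N + 4 * n%:R * s * eps.
have c'P k : (k < n.+1)%N -> game s k x (c' k).
  rewrite ltnS leq_eqVlt /c' => /predU1P[->|kn]; last by rewrite kn; exact: cP.
  have := @game_upper eps s m n x (c 0%N) eps0 s0 empty (cP 0%N isT).
  rewrite ltnn; apply: game_le; rewrite -addrA lerD2l.
  have : s * m%:R <= s * (n%:R * eps) by rewrite ler_pM2l.
  lra.
have c'sum : \sum_(k < n) c' k.+1 <= 2 * n%:R + 4 * n%:R * s * eps.
  have : \sum_(k < n.+1) c' k = \sum_(k < n) c k + (c 0%N + 4 * n%:R * s * eps).
    rewrite big_ord_recr /= {2}/c' ltnn; congr (_ + _).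
    by apply: eq_bigr => k _; rewrite /c' ltn_ord.
  rewrite big_ord_recl /= {1}/c' /=; under eq_bigr do rewrite /bump /= add1n.
  by move: csum; lra.
have [k kn|F FP] := @weak_nbhd_forall n (fun k y => game s k (x + s *: y) (c' k.+1)).
  by have := c'P k.+1; rewrite ltnS => /(_ kn).
exists F => y /FP yP; set t := 4 * s * eps.
have t0 : 0 <= t by rewrite !mulr_ge0// ltW.
have t1 : 0 < 1 + t by rewrite ltr_pwDl.
(* Contract towards [0], where all games have a value at most [1]. *)
exists (fun k => (1 + t)^-1 * c' k.+1 + (1 - (1 + t)^-1) * 1); split.
  move=> k kn; rewrite -[_ *: _]addr0 -(scaler0 _ (1 - (1 + t)^-1)).
  apply: game_convex (yP k kn) _.
    by rewrite invr_ge0 ltW//= invf_le1// lerDl.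
  apply: game_le (game_norm k 0 (ltW s0)).
  by rewrite normr0 add0r; apply: sn; exact: ltnW.
rewrite big_split /= -mulr_sumr sumr_const card_ord -mulr_natr mulr1.
have tn : (1 + t)^-1 * (\sum_(k < n) c' k.+1) <= (1 + t)^-1 * (2 * n%:R + t * n%:R).
  by rewrite ler_pM2l ?invr_gt0//; apply: le_trans c'sum _; rewrite /t; lra.
have tE : (1 + t)^-1 * (2 * n%:R + t * n%:R) + (1 - (1 + t)^-1) * n%:R = 2 * n%:R.
  by field; rewrite gt_eqF.
lra.
Qed.

End FlatSet.

(** * Renorming the dual *)

Section Renorming.
Context {R : realType} {X : normedModType R}.
Implicit Types (f g : dual X) (x y : X).

(** Take [y] to be half the difference of a vector that almost norms [g] and
    of a close one from a finite net, which is in [H] and hence killed by [g]. *)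
Lemma weak_nbhd_norming (F : seq (dual X)) :
  exists H, forall g, ann H g -> exists2 y, weak_nbhd F y & `|g| / 4 <= g y.
Proof.
have [H H1 HP] := @functional_net R X F 2 [set y | `|y| <= 1] (ltr0Sn R 1) (fun y => id).
exists H => g gH; have [y [y1 yg]] := dual_half_norming g.
have [y' y'H yy'] := HP y y1; have y'1 := H1 _ y'H.
exists ((2^-1 : R) *: (y - y')).
  split=> [|f fF].
    rewrite normrZ ger0_norm//; have := ler_normB y y'; move: y1 y'1 => /=; lra.
  rewrite dual_scaleE normrM ger0_norm//; have := yy' f fF; lra.
by rewrite dual_scaleE dual_subE (gH _ y'H) subr0; lra.
Qed.

Variables (s : nat -> R) (D : nat -> set X).
Hypothesis flatD : forall j, flat (j.+1%:R^-1) (s j) (D j).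

(** The supremum of a functional over [mixtures] is the sum of its suprema over
    the sets [D i], with weights [2^-(i+1)]. *)
Definition mixture (x_ : nat -> X) (n : nat) := \sum_(i < n) (2^-1 : R) ^+ i.+1 *: x_ i.

Definition mixtures : set X :=
  [set x | exists (x_ : nat -> X) n, (forall i, D i (x_ i)) /\ x = mixture x_ n].

Lemma mixtures_long x m : mixtures x ->
  exists (x_ : nat -> X) n, [/\ (forall i, D i (x_ i)), x = mixture x_ n & (m <= n)%N].
Proof.
move=> [x_ [n [xD ->]]]; exists (fun i => if (i < n)%N then x_ i else 0), (n + m)%N.
split; last exact: leq_addl.
  by move=> i; case: ifP => // _; have [_ + _ _] := flatD i; apply; rewrite normr0.
rewrite /mixture big_split_ord /= [X in _ + X]big1 ?addr0 => [|i _].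
  by apply: eq_bigr => i _; rewrite ltn_ord.
by rewrite ltnNge leq_addr/= scaler0.
Qed.

Lemma mixture_replace (x_ : nat -> X) n j z : (j < n)%N ->
  mixture (fun i => if i == j then z else x_ i) n =
  mixture x_ n + (2^-1 : R) ^+ j.+1 *: (z - x_ j).
Proof.
move=> jn; rewrite /mixture (bigD1 (Ordinal jn))//= [in RHS](bigD1 (Ordinal jn))//=.
rewrite eqxx scalerBr [RHS]addrC addrA subrK; congr (_ + _).
apply: eq_bigr => i ij; case: eqP => // iE; case/eqP: ij.
exact: val_inj.
Qed.

Lemma mixtures_bound x f : mixtures x -> `|f x : R| <= 2 * `|f|.
Proof.
move=> [x_ [n [xD ->]]].
suff : `|f (mixture x_ n) : R| <= (1 - 2^-1 ^+ n) * (2 * `|f|).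
  by move=> /le_trans; apply; rewrite ler_piMl ?mulr_ge0.
rewrite /mixture; elim: n => [|n IH].
  by rewrite big_ord0 dual_eval0 normr0 expr0 subrr mul0r.
rewrite big_ord_recr /= dual_addE dual_scaleE.
apply: le_trans (ler_normD _ _) _.
have [_ _ bound _] := flatD n.
have : `|2^-1 ^+ n.+1 * f (x_ n) : R| <= 2^-1 ^+ n.+1 * (2 * `|f|).
  by rewrite normrM ger0_norm ?exprn_ge0// ler_pM2l ?exprn_gt0//; exact: bound.
have -> : (2^-1 : R) ^+ n.+1 = 2^-1 * 2^-1 ^+ n by rewrite exprS.
move: IH; set a := `|f _|; set b := `|_ * _|; set p := _ ^+ n.
set q := `|f|; lra.
Qed.

Lemma mixtures_half x : `|x| <= 1 -> mixtures ((2^-1 : R) *: x).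
Proof.
move=> x1; exists (fun i => if i == 0%N then x else 0), 1%N; split.
  move=> i; have [_ + _ _] := flatD i; apply.
  by case: eqP; rewrite ?normr0.
by rewrite /mixture big_ord1 expr1.
Qed.

Definition mix_norm f : R := sup [set `|f x| | x in mixtures].

Lemma mix_norm_has_sup f : has_sup [set `|f x| | x in mixtures].
Proof.
split; last by exists (2 * `|f|) => _ [x /(mixtures_bound f) + <-].
by exists `|f ((2^-1 : R) *: 0)|, ((2^-1 : R) *: 0) => //; apply: mixtures_half; rewrite normr0.
Qed.

Lemma mix_norm_ub f x : mixtures x -> `|f x : R| <= mix_norm f.
Proof. by move=> xM; apply: (sup_upper_bound (mix_norm_has_sup f)); exists x. Qed.

Lemma mix_norm_le f (M : R) : (forall x, mixtures x -> `|f x : R| <= M) -> mix_norm f <= M.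
Proof.
move=> fM; apply: ge_sup; first by case: (mix_norm_has_sup f).
by move=> _ [x xM <-]; exact: fM.
Qed.

Lemma mix_normZ_le (a : R) f : mix_norm (a *: f) <= `|a| * mix_norm f.
Proof.
by apply: mix_norm_le => x xM; rewrite dualZE normrM ler_wpM2l// mix_norm_ub.
Qed.

Lemma mix_norm_bounds f : 2^-1 * `|f| <= mix_norm f <= 2 * `|f|.
Proof.
apply/andP; split; last by apply: mix_norm_le => x; exact: mixtures_bound.
suff : `|f| <= 2 * mix_norm f by lra.
apply: dual_norm_le => x x1; have := mix_norm_ub f (mixtures_half x1).
by rewrite dual_scaleE normrM ger0_norm//; set a := `|_|; lra.
Qed.

Lemma mix_norm_equivalent : is_equivalent_norm mix_norm.
Proof.
split.
- move=> f g; apply: mix_norm_le => x xM; rewrite dualDE.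
  by apply: le_trans (ler_normD _ _) _; rewrite lerD// mix_norm_ub.
- move=> a f; apply/eqP; rewrite eq_le mix_normZ_le/=.
  have [->|a0] := eqVneq a 0.
    by rewrite normr0 mul0r; have := mix_norm_bounds (0 *: f); have := normr_ge0 (0 *: f); lra.
  rewrite -ler_pdivlMl ?normr_gt0// -normfV.
  have := mix_normZ_le a^-1 (a *: f).
  by rewrite scalerA mulVf// scale1r.
- move=> f f0; apply/eqP; rewrite -normr_eq0 eq_le normr_ge0 andbT.
  by have := mix_norm_bounds f; rewrite f0; lra.
- by exists 2^-1, 2; split=> //; exact: mix_norm_bounds.
Qed.

(** Let [x] be a mixture that almost norms [f], let [g] vanish at [x] and at its
    [j]-th component [x_ j], and let [y] be weakly small with [g y] large.
    Replacing [x_ j] by [(1 + tau)^-1 *: (x_ j + s j *: y)], up to the sign of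
    [y], gives another mixture.  The value of [f + t *: g] gains a multiple of
    [s j * t * g y] and loses at most a multiple of [tau], which is small
    compared to [s j * t] for a suitable [j] that depends on [t] only. *)
Lemma mix_norm_AUC : AUC mix_norm.
Proof.
move=> t t0; apply/inf_sup_inf_gt0.
have [j jt] : exists j, j.+1%:R^-1 <= Num.min (t / 256) 4^-1.
  have m0 : 0 < Num.min (t / 256) 4^-1 :> R by rewrite lt_min divr_gt0//= invr_gt0.
  exists (Num.truncn (Num.min (t / 256) 4^-1)^-1).
  by rewrite invf_ple ?posrE//; exact: ltW (truncnS_gt _).
move: jt; rewrite le_min => /andP[jt j4].
have [/andP[s0 s1] _ Db Dflat] := flatD j.
set e := j.+1%:R^-1 in jt j4 Dflat.
have e0 : 0 < e by rewrite invr_gt0.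
set S := s j in s0 s1 Dflat; pose tau := 4 * S * e.
pose p : R := 2^-1 ^+ j.+1; have p0 : 0 < p by rewrite exprn_gt0.
pose d := p * (S * t / 128).
have d0 : 0 < d by rewrite !mulr_gt0// invr_gt0.
exists d => // f Nf.
have [_ [x xM <-]] := sup_adherent d0 (mix_norm_has_sup f).
rewrite -/(mix_norm f) Nf => fx.
have [x_ [n [xD xE jn]]] := mixtures_long j.+1 xM.
have [F FP] := Dflat _ (xD j).
have [H HP] := weak_nbhd_norming ((64 / t) *: f :: F).
exists (ann (x :: x_ j :: H)); first exact: ann_cof.
move=> g /ann_cons[gx /ann_cons[gxj /HP[y yF gy]]] Ng.
have g2 : 2^-1 <= `|g| by have := mix_norm_bounds g; rewrite Ng; lra.
have f2 : `|f| <= 2 by have := mix_norm_bounds f; rewrite Nf; lra.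
have fy : `|f y : R| <= t / 64.
  have k0 : 0 < 64 / t by rewrite divr_gt0.
  have [_ /(_ _ (mem_head _ _))] := yF; rewrite dualZE normrM gtr0_norm// => le.
  rewrite -(ler_pM2l k0); apply: le_trans le _.
  have -> : 64 / t * (t / 64) = 1 by field; rewrite gt_eqF.
  exact: lexx.
have yF' : weak_nbhd F y by apply: weak_nbhd_sub yF => h hF; rewrite inE hF orbT.
(* The sign makes the gain along [y] add to [`|f x|]. *)
pose sg : R := if 0 <= f x :> R then 1 else -1.
have sgf : sg * f x = `|f x : R|.
  by rewrite /sg; case: ger0P => _; rewrite ?mul1r ?mulN1r.
have sg1 : sg * sg = 1 by rewrite /sg; case: ifP => _; rewrite ?mulrNN mulr1.
have sgn : `|sg| = 1 by rewrite /sg; case: ifP => _; rewrite ?normrN normr1.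
have ysF : weak_nbhd F (sg *: y).
  by rewrite /sg; case: ifP => _; rewrite ?scale1r// scaleN1r; exact: weak_nbhdN.
pose z := (1 + tau)^-1 *: (x_ j + S *: (sg *: y)).
have zD : D j z by apply: FP.
pose x' := mixture (fun i => if i == j then z else x_ i) n.
have x'M : mixtures x'.
  exists (fun i => if i == j then z else x_ i), n; split=> // i.
  by case: eqP => [->|].
rewrite lerBrDl; apply: le_trans (mix_norm_ub (f + t *: g) x'M).
apply: (@le_trans _ _ (sg * (f + t *: g) x')); last first.
  by apply: le_trans (ler_norm _) _; rewrite normrM sgn mul1r.
rewrite /x' mixture_replace// -xE -/p.
have tau0 : 0 <= tau by rewrite !mulr_ge0// ltW.
have tau1 : tau <= 1.
  have : S * e <= e by rewrite ler_piMl// ltW.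
  by rewrite /tau; lra.
pose r := (1 + tau)^-1; have r2 : 2^-1 <= r by rewrite lef_pV2 ?posrE; lra.
have r1 : r * (1 + tau) = 1 by rewrite mulVf// gt_eqF; lra.
pose q := sg * f (x_ j).
have q4 : `|q| <= 4 by rewrite normrM sgn mul1r; have := Db _ f (xD j); lra.
have -> : sg * (f + t *: g) (x + p *: (z - x_ j)) =
    `|f x : R| + p * (r * (q + S * f y + S * (t * g y)) - q).
  rewrite dualDE dualZE !dual_addE !dual_scaleE !dual_subE /z !dual_scaleE.
  rewrite !dual_addE !dual_scaleE gx gxj -/r -sgf /q.
  have -> : S * f y = sg * sg * (S * f y) by rewrite sg1 mul1r.
  have -> : S * (t * g y) = sg * sg * (S * (t * g y)) by rewrite sg1 mul1r.
  by ring.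
have gain : S * t / 64 <= r * (q + S * f y + S * (t * g y)) - q.
  have -> : r * (q + S * f y + S * (t * g y)) - q =
      r * (S * f y + S * (t * g y) - tau * q) + (r * (1 + tau) - 1) * q by ring.
  rewrite r1 subrr mul0r addr0.
  have St0 : 0 < S * t by rewrite mulr_gt0.
  have h1 : - (S * (t / 64)) <= S * f y.
    by rewrite -mulrN ler_pM2l//; move: fy; rewrite ler_norml => /andP[].
  have h2 : S * (t * (1 / 8)) <= S * (t * g y) by rewrite !ler_pM2l//; lra.
  have h3 : tau * q <= S * (t / 16).
    apply: (@le_trans _ _ (tau * 4)).
      by rewrite ler_wpM2l//; apply: le_trans (ler_norm _) q4.
    have : S * e <= S * (t / 256) by rewrite ler_pM2l.
    by rewrite /tau; lra.
  apply: (@le_trans _ _ (2^-1 * (S * t * (3 / 64)))); first lra.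
  apply: ler_pM => //; lra.
have : p * (S * t / 64) <= p * (r * (q + S * f y + S * (t * g y)) - q).
  by rewrite ler_pM2l.
by move: fx; rewrite /d; lra.
Qed.

End Renorming.

Unset Implicit Arguments.

Theorem mainTheorem9 (R : realType) (X : completeNormedModType R)
    (hX : separable X)
    (hU : weak_star_unconditional_asymptotic_structure X) :
  (exists N : dual X -> R, is_equivalent_norm N /\ AMUC N) <->
  (exists N : dual X -> R, is_equivalent_norm N /\ AUC N).
Proof.
split=> [[N [hN amucN]]|[N [hN aucN]]].
  have /choice[s sP] : forall j : nat, exists s : R, exists D : set X,
      flat j.+1%:R^-1 s D.
    by move=> j; apply: flat_set; [|apply: szlenk_empty hN amucN hU _ _];
       rewrite invr_gt0.
  have [D flatD] := choice sP.
  exists (mix_norm D); split; first exact: mix_norm_equivalent flatD.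
  exact: mix_norm_AUC flatD.
exists N; split=> // t /aucN/inf_sup_inf_gt0[d d0 dP].
apply/inf_sup_inf_gt0; exists d => // z /dP[Y cY YP]; exists Y => // y Yy Ny.
by apply: le_trans (YP y Yy Ny) _; rewrite lerB// le_max lexx.
Qed.
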